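(* Let $A$ be an $m\times m$ nonnegative definite hermitian matrix. Assume that its smallest eigenvalue satisfies $\lambda_m(A)\ge1$. Then the function $w:2^{[m]}\to\mathbb{R}$, $w(I):=\operatorname{tr}\log A[I]$, is nondecreasing, i.e. $w(I)\le w(J)$ whenever $I\subset J\subset[m]$.
   Context: $[m]=\{1,\dots,m\}$. $A[I]$ is the principal submatrix of $A$ with rows and columns indexed by $I$; $w(\emptyset)=0$. Thus $w(I)=\log\det A[I]$ with $\det A[\emptyset]=1$. Eigenvalues are ordered $\lambda_1(A)\ge\dots\ge\lambda_m(A)$. *)

(* Defs.v *)
From HB Require Import structures.
From mathcomp Require Import all_boot all_order all_algebra.
From mathcomp Require Import spectral sesquilinear.
From mathcomp Require Import complex.
From mathcomp Require Import reals exp.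

Set Implicit Arguments.
Unset Strict Implicit.
Unset Printing Implicit Defensive.

Import Order.TTheory GRing.Theory Num.Theory.

Local Open Scope ring_scope.
Local Open Scope complex_scope.
Local Open Scope sesquilinear_scope.

(* Nonnegative definite hermitian: A = A^* and x^* A x >= 0 for every x.
   In the partial order of R[i], 0 <= z means that z is real and
   nonnegative. *)
Definition psdhermmx (R : realType) m (A : 'M[R[i]]_m) : Prop :=
  A \is hermsymmx /\
  forall x : 'cV[R[i]]_m, 0 <= (x ^t* *m A *m x) ord0 ord0.

(* The m complex roots of the characteristic polynomial, with
   multiplicity. *)
Definition char_roots (R : realType) m (A : 'M[R[i]]_m) : seq R[i] :=
  sval (closed_field_poly_normal (char_poly A)).

(* lambda A k is the k-th largest eigenvalue (1 <= k <= m) of a hermitian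
   A, counted with multiplicity; its eigenvalues being real, taking real
   parts loses nothing.  For m = 0 there are none and lambda A m = 0. *)
Definition lambda (R : realType) m (A : 'M[R[i]]_m) (k : nat) : R :=
  nth 0 (sort >=%R [seq complex.Re z | z <- char_roots A]) k.-1.

(* A[I]; its rows and columns are listed in increasing order of index. *)
Definition principal_submx (R : realType) m (A : 'M[R[i]]_m)
    (I : {set 'I_m}) : 'M[R[i]]_#|I| :=
  \matrix_(i < #|I|, j < #|I|) A (enum_val i) (enum_val j).

(* Logarithm of a positive definite hermitian matrix by functional
   calculus: from X = U^-1 diag(d) U with U unitary and d > 0,
   log X = U^-1 diag(ln d) U. *)
Definition mxlog (R : realType) n (X : 'M[R[i]]_n) : 'M[R[i]]_n :=
  invmx (spectralmx X)
    *m diag_mx (map_mx (fun z => (ln (complex.Re z))%:C) (spectral_diag X))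
    *m spectralmx X.

(* The trace is real, since mxlog X is similar to a real diagonal matrix. *)
Definition trlog (R : realType) m (A : 'M[R[i]]_m) (I : {set 'I_m}) : R :=
  complex.Re (\tr (mxlog (principal_submx A I))).

(* Main.v *)
Require Import Defs.
From mathcomp Require Import all_boot all_order all_algebra.
From mathcomp Require Import complex reals.
From mathcomp Require Import fingroup perm spectral sesquilinear exp.

Set Implicit Arguments.
Unset Strict Implicit.
Unset Printing Implicit Defensive.

Import Order.TTheory GRing.Theory Num.Theory.
Local Open Scope ring_scope.
Local Open Scope complex_scope.

(** The trace of the logarithm of a positive definite matrix is the logarithm
    of its determinant ([tr_mxlog]), so the claim is that
    [\det A[I] <= \det A[J]] when [I \subset J].

    The eigenvalue hypothesis is used only through the resulting inequality
    of quadratic forms [v v^* <= v A v^*], called [ge1mx] below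
    ([lambda_ge1_ge1mx]).  Unlike a statement about eigenvalues, this form
    passes at once to every compression [Q X Q^*] by a matrix [Q] such that
    [v |-> v Q] does not shorten vectors ([ge1mx_congr]).  Two such
    compressions carry the proof.

    - With [Q] a selection of coordinates, principal submatrices inherit the
      property; their eigenvalues are then at least [1], and so are their
      determinants ([ge1mx_det_ge1]).
    - List the indices of [J] with those of [I] first, so that [A[J]] has the
      blocks [M = A[I]], [B], [B^*], [D].  With [Q = (- B^* M^-1, 1)], the
      compression is the Schur complement [S = D - B^* M^-1 B]
      ([ge1mx_schur]), and [v |-> v Q] does not shorten because the second
      component of [v Q] is [v] itself.  Hence [1 <= \det S], and
      [\det A[J] = \det A[I] * \det S >= \det A[I]] ([ge1mx_det_ulsubmx]).

    The determinant does not depend on the order in which [J] is listed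
    ([det_mxsub_codom]), which lets the block order above replace the
    increasing one. *)

(** * Hermitian matrices bounded below by the identity *)

Section LoewnerAboveIdentity.
Context {C : numClosedFieldType}.
Local Open Scope sesquilinear_scope.

Lemma conjtr_mul m n p (A : 'M[C]_(m, n)) (B : 'M[C]_(n, p)) :
  (A *m B) ^t* = B ^t* *m A ^t*.
Proof. by rewrite trmx_mul map_mxM. Qed.

Lemma dotmx_ge0 n (v : 'rV[C]_n) : 0 <= (v *m v ^t*) 0 0.
Proof.
by rewrite mxE; apply: sumr_ge0 => k _; rewrite !mxE -normCK exprn_ge0.
Qed.

(** The Loewner inequality [1 <= X] between hermitian matrices, with the
    quadratic form written on row vectors, as the spectral theorem for
    [spectralmx] diagonalizes by acting on rows. *)
Definition ge1mx {n} (X : 'M[C]_n) : Prop :=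
  X ^t* = X /\ forall v : 'rV_n, (v *m v ^t*) 0 0 <= (v *m X *m v ^t*) 0 0.

Lemma ge1mx_normal n (X : 'M[C]_n) : ge1mx X -> X \is normalmx.
Proof. by case=> XH _; apply/normalmxP; rewrite XH. Qed.

Lemma ge1mx_congr m n (Q : 'M[C]_(m, n)) (X : 'M[C]_n) :
    (forall v : 'rV_m, (v *m v ^t*) 0 0 <= (v *m Q *m (v *m Q) ^t*) 0 0) ->
  ge1mx X -> ge1mx (Q *m X *m Q ^t*).
Proof.
move=> Qexp [XH Xge]; split=> [|v].
  by rewrite !conjtr_mul trmxCK XH mulmxA.
apply: le_trans (Qexp v) (le_trans (Xge _) _).
by rewrite conjtr_mul !mulmxA.
Qed.

Lemma ge1mx_unitary m n (Q : 'M[C]_(m, n)) (X : 'M[C]_n) :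
  Q \is unitarymx -> ge1mx X -> ge1mx (Q *m X *m Q ^t*).
Proof.
move=> /unitarymxP QQ; apply: ge1mx_congr => v.
by rewrite conjtr_mul -mulmxA [Q *m _]mulmxA QQ mul1mx.
Qed.

(** In the spectral basis the form is [\sum_i d_i |v_i|^2], which dominates
    [\sum_i |v_i|^2] term by term; the unitary change of basis preserves
    this. *)
Lemma ge1mx_spectral n (X : 'M[C]_n) :
  X ^t* = X -> (forall i, 1 <= spectral_diag X 0 i) -> ge1mx X.
Proof.
move=> XH dge1; have Xn : X \is normalmx by apply/normalmxP; rewrite XH.
have Uu := spectral_unitarymx X; rewrite (orthomx_spectralP Xn).
rewrite invmx_unitary // -[Y in _ *m Y]trmxCK.
apply: ge1mx_unitary; first by rewrite trmxC_unitary.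
split=> [|v].
  rewrite tr_diag_mx map_diag_mx; congr diag_mx.
  by apply/rowP => i; rewrite mxE; apply/geC0_conj/(le_trans ler01).
rewrite mul_mx_diag !mxE; apply: ler_sum => i _; rewrite !mxE.
by rewrite mulrAC -normCK ler_peMr ?exprn_ge0.
Qed.

(** Conversely, the form of the diagonalized matrix at the [i]-th basis
    vector, a unit vector, is the [i]-th eigenvalue. *)
Lemma spectral_diag_ge1 n (X : 'M[C]_n) i :
  ge1mx X -> 1 <= spectral_diag X 0 i.
Proof.
move=> Xge1; set U := spectralmx X.
have Uu : U \is unitarymx := spectral_unitarymx X.
have XE := orthomx_spectralP (ge1mx_normal Xge1).
rewrite -/U invmx_unitary // in XE.
have DE : U *m X *m U ^t* = diag_mx (spectral_diag X).
  rewrite [Y in U *m Y]XE !mulmxA (unitarymxP Uu) mul1mx -mulmxA.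
  by rewrite (unitarymxP Uu) mulmx1.
have [_ /(_ (delta_mx 0 i))] := ge1mx_unitary Uu Xge1.
rewrite DE trmx_delta map_delta_mx mul_delta_mx -rowE row_diag_mx.
by rewrite -scalemxAl mul_delta_mx !mxE !eqxx mulr1.
Qed.

Lemma det_spectral n (X : 'M[C]_n) :
  X \is normalmx -> \det X = \prod_i spectral_diag X 0 i.
Proof.
move=> /orthomx_spectralP XE; rewrite [in LHS]XE !det_mulmx det_inv mulrAC.
by rewrite mulVr ?mul1r ?det_diag // -unitmxE spectral_unit.
Qed.

Lemma ge1mx_det_ge1 n (X : 'M[C]_n) : ge1mx X -> 1 <= \det X.
Proof.
move=> Xge1; rewrite det_spectral ?ge1mx_normal //.
apply: (big_ind (fun z => 1 <= z)) => // [z t|i _]; first exact: mulr_ege1.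
exact: spectral_diag_ge1.
Qed.

(** Injectivity of [f] makes the rows of the selection matrix
    [rowsub f 1%:M] orthonormal, so that extracting a principal submatrix is
    a compression by an isometry. *)
Lemma ge1mx_mxsub m n (f : 'I_n -> 'I_m) (X : 'M[C]_m) :
  injective f -> ge1mx X -> ge1mx (mxsub f f X).
Proof.
move=> f_inj Xge1.
have -> : mxsub f f X = rowsub f 1%:M *m X *m (rowsub f 1%:M) ^t*.
  rewrite trmx_mxsub map_mxsub trmx1 map_mx1 -rowsubE.
  by rewrite mulmx_colsub mulmx1 -mxsub_comp.
apply: ge1mx_unitary => //; apply/unitarymxP.
rewrite trmx_mxsub map_mxsub trmx1 map_mx1 -rowsubE.
by apply/matrixP => i j; rewrite !mxE (inj_eq f_inj).
Qed.

(** The row [(- L, 1)], with [L] the lower left block times [M^-1], clears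
    the lower left block; compressing by it therefore leaves the Schur
    complement, while [|v (- L, 1)|^2 = |v L|^2 + |v|^2 >= |v|^2]. *)
Lemma ge1mx_schur m n (X : 'M[C]_(m + n)) :
    let M := ulsubmx X in
  M \in unitmx -> ge1mx X ->
  ge1mx (drsubmx X - dlsubmx X *m invmx M *m ursubmx X).
Proof.
move=> M Mu Xge1; set L := - (dlsubmx X *m invmx M).
pose Q := row_mx L (1%:M : 'M_n).
have QXE : Q *m X = row_mx 0 (drsubmx X - dlsubmx X *m invmx M *m ursubmx X).
  rewrite -[X in Q *m X]submxK mul_row_block !mul1mx !mulNmx mulmxKV //.
  by rewrite addNr addrC.
have <- : Q *m X *m Q ^t* = drsubmx X - dlsubmx X *m invmx M *m ursubmx X.
  rewrite QXE tr_row_mx map_col_mx mul_row_col mul0mx add0r trmx1 map_mx1.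
  by rewrite mulmx1.
apply: ge1mx_congr => // v.
rewrite mul_mx_row mulmx1 tr_row_mx map_col_mx mul_row_col.
by rewrite [leRHS]mxE lerDr dotmx_ge0.
Qed.

(** Block elimination factors [\det X] as [\det M] times the determinant of
    the Schur complement of [M], and the latter is at least [1]. *)
Lemma ge1mx_det_ulsubmx m n (X : 'M[C]_(m + n)) :
  ge1mx X -> \det (ulsubmx X) <= \det X.
Proof.
move=> Xge1; set M := ulsubmx X.
have Mge1 : ge1mx M.
  have -> : M = mxsub (@lshift m n) (@lshift m n) X.
    by apply/matrixP => i j; rewrite !mxE.
  by apply: ge1mx_mxsub => //; apply: lshift_inj.
have M0 : 0 < \det M := lt_le_trans ltr01 (ge1mx_det_ge1 Mge1).
have Mu : M \in unitmx by rewrite unitmxE unitfE gt_eqF.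
have := ge1mx_det_ge1 (ge1mx_schur Mu Xge1).
set S := _ - _ => S1.
suff -> : \det X = \det M * \det S by rewrite ler_peMr // ltW.
rewrite -(det_ublock M (ursubmx X)).
have <- : block_mx 1%:M 0 (- (dlsubmx X *m invmx M)) 1%:M *m X =
          block_mx M (ursubmx X) 0 S.
  rewrite -[X in _ *m X]submxK mulmx_block !mul1mx !mul0mx !addr0 -/M.
  by rewrite !mulNmx mulmxKV // addNr addrC.
by rewrite det_mulmx det_lblock !det1 !mul1r.
Qed.

End LoewnerAboveIdentity.

(** * Principal minors indexed by sets *)

(** The two enumerations differ by a permutation, applied to both rows and
    columns, so its sign occurs squared. *)
Lemma det_mxsub_codom (R : comNzRingType) m n p (f : 'I_n -> 'I_m)
    (g : 'I_p -> 'I_m) (A : 'M[R]_m) :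
    n = p -> injective g -> (forall j, exists i, g j = f i) ->
  \det (mxsub f f A) = \det (mxsub g g A).
Proof.
move=> np; case: _ / np in g * => g_inj gf.
have [s gE] := fin_all_exists gf.
have s_inj : injective s by move=> j k sjk; apply: g_inj; rewrite !gE sjk.
pose t := perm s_inj.
have -> : mxsub g g A = row_perm t (col_perm t (mxsub f f A)).
  by apply/matrixP => j k; rewrite !mxE !permE !gE.
rewrite row_permE col_permE !det_mulmx !det_perm odd_permV mulrCA.
by rewrite -signr_addb addbb mulr1.
Qed.

Lemma det_principal_le (R : realType) m (A : 'M[R[i]]_m) (I J : {set 'I_m}) :
    I \subset J -> ge1mx A ->
  \det (principal_submx A I) <= \det (principal_submx A J).
Proof.
move=> IJ Age1.
(* Enumerate J with the elements of I first. *)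
pose f (k : 'I_(#|I| + #|J :\: I|)) : 'I_m :=
  match split k with inl i => enum_val i | inr j => enum_val j end.
have fl i : f (lshift _ i) = enum_val i by rewrite /f (unsplitK (inl _ i)).
have fr j : f (rshift _ j) = enum_val j by rewrite /f (unsplitK (inr _ j)).
have f_inj : injective f.
  move=> k l; rewrite -[k]splitK -[l]splitK.
  case: (split k) (split l) => [i|j] [i'|j'] /=; rewrite ?fl ?fr.
  - by move/enum_val_inj->.
  - by move=> e; have := enum_valP j'; rewrite -e inE enum_valP.
  - by move=> e; have := enum_valP j; rewrite e inE enum_valP.
  - by move/enum_val_inj->.
have fJ j : exists k, enum_val (j : 'I_#|J|) = f k.
  have jJ := enum_valP j; have [jI|jI] := boolP (enum_val j \in I).
    exists (lshift _ (enum_rank_in jI (enum_val j))).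
    by rewrite fl enum_rankK_in.
  have jD : enum_val j \in J :\: I by rewrite inE jI.
  by exists (rshift _ (enum_rank_in jD (enum_val j))); rewrite fr enum_rankK_in.
have cIJ : (#|I| + #|J :\: I|)%N = #|J|.
  by rewrite cardsD (setIidPr IJ) subnKC // subset_leq_card.
have := ge1mx_det_ulsubmx (ge1mx_mxsub f_inj Age1).
rewrite (det_mxsub_codom A cIJ enum_val_inj fJ).
congr (_ <= _); congr (\det _); apply/matrixP => i j.
by rewrite !mxE !fl.
Qed.

(** * Eigenvalues and logarithm *)

(** Each entry of the spectral diagonal is a root of the characteristic
    polynomial, so its real part occurs in the decreasing list of [m]
    numbers whose last one is [lambda A m]. *)
Lemma lambda_ge1_ge1mx (R : realType) m (A : 'M[R[i]]_m) :
  A \is hermsymmx -> 1 <= lambda A m -> ge1mx A.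
Proof.
move=> AH lam1; have AE := is_hermitianmxP _ _ _ AH.
rewrite expr0 scale1r in AE; apply: ge1mx_spectral => // i.
set d := spectral_diag A 0 i.
have dr : d \is Num.real.
  by have /mxOverP := hermitian_spectral_diag_real AH; apply.
pose U := spectralmx A.
have Uu : U \is unitarymx := spectral_unitarymx A.
have An := orthomx_spectralP (hermitian_normalmx AH).
have UA : U *m A = diag_mx (spectral_diag A) *m U.
  by rewrite [in LHS]An -/U !mulmxA mulmxV ?mul1mx ?spectral_unit.
have d_eig : eigenvalue A d.
  apply/eigenvalueP; exists (row i U).
    by rewrite -row_mul UA row_mul row_diag_mx -scalemxAl -rowE.
  apply/eqP => rU0; have /row_unitarymxP/(_ i i) := Uu.
  by rewrite rU0 eqxx dotmxE mul0mx mxE => /esym/eqP; rewrite oner_eq0.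
have chE := svalP (closed_field_poly_normal (char_poly A)).
rewrite -/(char_roots A) (monicP (char_poly_monic A)) scale1r in chE.
have d_root : d \in char_roots A.
  by move: d_eig; rewrite eigenvalue_root_char chE root_prod_XsubC.
pose s := sort >=%R [seq complex.Re z | z <- char_roots A].
have sz : size s = m.
  rewrite size_sort size_map; apply/succn_inj.
  by rewrite -(size_prod_XsubC _ id) -chE size_char_poly.
have ds : complex.Re d \in s by rewrite mem_sort map_f.
have Re1 : 1 <= complex.Re d.
  apply: le_trans lam1 _; rewrite -(nth_index 0 ds).
  have m0 : (0 < m)%N by rewrite (leq_ltn_trans _ (ltn_ord i)).
  have ls : (index (complex.Re d) s < m)%N by rewrite -sz index_mem.
  apply: (sorted_leq_nth ge_trans ge_refl 0 (sort_sorted ge_total _));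
    rewrite ?inE ?sz ?prednK //.
  by rewrite -ltnS prednK.
by rewrite -(RRe_real dr) -(rmorph1 (real_complex R)) lecR.
Qed.

Lemma ln_prod (R : realType) (I : finType) (F : I -> R) :
  (forall i, 0 < F i) -> \sum_i ln (F i) = ln (\prod_i F i).
Proof.
move=> F0.
suff [] : 0 < \prod_i F i /\ \sum_i ln (F i) = ln (\prod_i F i) by [].
elim/big_rec2: _ => [|i y x _ [y0 ->]]; first by rewrite ltr01 ln1.
by rewrite lnM ?posrE // mulr_gt0.
Qed.

Lemma tr_mxlog (R : realType) n (X : 'M[R[i]]_n) :
  ge1mx X -> complex.Re (\tr (mxlog X)) = ln (complex.Re (\det X)).
Proof.
move=> Xge1; pose d i := complex.Re (spectral_diag X 0 i).
have dE i : spectral_diag X 0 i = (d i)%:C.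
  by rewrite RRe_real // ger0_real // (le_trans ler01) // spectral_diag_ge1.
have d0 i : 0 < d i.
  apply: (lt_le_trans ltr01).
  have := spectral_diag_ge1 i Xge1.
  by rewrite dE -(rmorph1 (real_complex R)) lecR.
rewrite /mxlog mxtrace_mulC mulmxA mulmxV ?spectral_unit // mul1mx mxtrace_diag.
rewrite det_spectral ?ge1mx_normal // (eq_bigr _ (fun i _ => dE i)).
rewrite -rmorph_prod /= -ln_prod //.
by under eq_bigr do rewrite mxE; rewrite -rmorph_sum.
Qed.

Theorem lemma13 (R : realType) (m : nat) (A : 'M[R[i]]_m)
  (hA : psdhermmx A) (hlambda : 1 <= lambda A m)
  (I J : {set 'I_m}) (hIJ : I \subset J) :
  trlog A I <= trlog A J.
Proof.
have Age1 := lambda_ge1_ge1mx (proj1 hA) hlambda.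
have principal_ge1 K : ge1mx (principal_submx A K).
  have -> : principal_submx A K = mxsub enum_val enum_val A.
    by apply/matrixP => i j; rewrite !mxE.
  exact: ge1mx_mxsub enum_val_inj Age1.
rewrite /trlog !tr_mxlog //.
have det_ge1 K := ge1mx_det_ge1 (principal_ge1 K).
have det_gt0 K : 0 < complex.Re (\det (principal_submx A K)).
  by apply: lt_le_trans ltr01 _; have := det_ge1 K; rewrite lecE => /andP[].
rewrite ler_ln ?posrE //.
by have := det_principal_le hIJ Age1; rewrite lecE => /andP[].
Qed.
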